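(* Let $\mathcal{C}_1,\dots,\mathcal{C}_p\subseteq\{1,\dots,n\}$ be the maximal cliques of a chordal graph on $\{1,\dots,n\}$. Each of the following three conic projection steps requires $\mathcal{O}\left(\sum_{k=1}^p|\mathcal{C}_k|^3\right)$ floating-point operations: (1) (Algorithm 1) the computation of $$x_k^{(n+1)}=\mathrm{vec}\left\{\mathbb{P}_{\mathbb{S}_+^{|\mathcal{C}_k|}}\left[\mathrm{mat}\left(H_kx^{(n+1)}-\rho^{-1}\lambda_k^{(n)}\right)\right]\right\},\quad k=1,\dots,p;$$ (2) (Algorithm 2) the computation of $$z_k^{(n+1)}=\mathrm{vec}\left\{\mathbb{P}_{\mathbb{S}_+^{|\mathcal{C}_k|}}\left[\mathrm{mat}\left(v_k^{(n+1)}-\rho^{-1}\lambda_k^{(n)}\right)\right]\right\},\quad k=1,\dots,p;$$ (3) (Algorithm 3) the projection $u^{(n+1)}=\mathbb{P}_{\mathcal{K}}\left(\hat u^{(n+1)}-v^{(n)}\right)$ onto the cone $$\mathcal{K}=\mathbb{R}^{n^2}\times\mathcal{S}\times\mathbb{R}^m\times\mathbb{R}^{n_d}\times\mathbb{R}_+,\qquad \mathcal{S}=\mathcal{S}_1\times\cdots\times\mathcal{S}_p.$$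
   Context: Notation: $\mathbb{S}^r$ is the space of $r\times r$ symmetric matrices, $\mathbb{S}^r_+$ the cone of positive semidefinite ones, and $\mathbb{P}_{\mathcal{W}}$ denotes the Euclidean (Frobenius) projection onto a closed convex cone $\mathcal{W}$. The map $\mathrm{vec}$ stacks the columns of a matrix and $\mathrm{mat}=\mathrm{vec}^{-1}$. $\mathcal{S}_k=\{x\in\mathbb{R}^{|\mathcal{C}_k|^2}:\mathrm{mat}(x)\in\mathbb{S}^{|\mathcal{C}_k|}_+\}$, $n_d=\sum_{k=1}^p|\mathcal{C}_k|^2$, $m\ge1$ is an integer (the number of equality constraints of the semidefinite program), and $\rho>0$. For a clique $\mathcal{C}_k$ with vertices in the natural order, $E_{\mathcal{C}_k}\in\mathbb{R}^{|\mathcal{C}_k|\times n}$ has $(E_{\mathcal{C}_k})_{ij}=1$ if $j$ is the $i$-th vertex of $\mathcal{C}_k$ and $0$ otherwise, and $H_k=E_{\mathcal{C}_k}\otimes E_{\mathcal{C}_k}\in\mathbb{R}^{|\mathcal{C}_k|^2\times n^2}$. The superscript $(n)$ is an iteration index (unrelated to the dimension $n$). The vectors $x^{(n+1)}\in\mathbb{R}^{n^2}$ and $v_k^{(n+1)},\lambda_k^{(n)}\in\mathbb{R}^{|\mathcal{C}_k|^2}$ are given current iterates. In step (3) what is counted is the evaluation of $\mathbb{P}_{\mathcal{K}}$ at the vector $\hat u^{(n+1)}-v^{(n)}\in\mathbb{R}^{n^2+2n_d+m+1}$. Algorithms 1, 2 and 3 are alternating direction method of multipliers (ADMM) schemes for,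 respectively, the chordally decomposed primal semidefinite program, the chordally decomposed dual semidefinite program, and the homogeneous self-dual embedding of this primal-dual pair; the displayed steps are their conic projection steps. Flop-counting convention: a flop is one addition, subtraction, multiplication or division of two floating-point numbers. Multiplication by $H_k$ is an indexing operation and costs no flops; taking $\max\{0,a\}$ costs no flops. Projections onto the positive semidefinite cone $\mathbb{S}^r_+$ are computed by a full eigenvalue decomposition, with cost $\mathcal{O}(r^3)$ flops. *)

(* Defs.v *)
From mathcomp Require Import all_boot all_order all_algebra.
From mathcomp Require Import boolp classical_sets reals.
From mathcomp Require Import mxtens.

Set Implicit Arguments.
Unset Strict Implicit.
Unset Printing Implicit Defensive.

Import Order.TTheory GRing.Theory Num.Theory.
Local Open Scope ring_scope.

Section Graphs.

Variable n : nat.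
Implicit Types (e : rel 'I_n) (A : {set 'I_n}).

Definition simple_graph e : Prop := symmetric e /\ irreflexive e.

(* Every cycle of length at least 4 has a chord, i.e. an edge between two
   vertices of the cycle that are not consecutive on it. *)
Definition chordal e : Prop :=
  forall s : seq 'I_n, ucycle e s -> (4 <= size s)%N ->
    exists x y, [/\ x \in s, y \in s, e x y, y != next s x & x != next s y].

Definition clique e A : bool :=
  [forall x in A, forall y in A, (x != y) ==> e x y].

Definition enumerates_maximal_cliques e p (C : 'I_p -> {set 'I_n}) : Prop :=
  injective C /\ forall A, maxset (clique e) A <-> exists k, C k = A.

End Graphs.

(* n_d, the total size of the vectorized cliques. *)
Definition sqdim n p (C : 'I_p -> {set 'I_n}) : nat :=
  (\sum_(k < p) #|C k| * #|C k|)%N.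

Section Matrices.

Variable R : realType.

(* Column stacking: entry j * a + i of [vec A] is A i j. *)
Definition vec a b (A : 'M[R]_(a, b)) : 'cV[R]_(b * a) :=
  \col_k A (mxtens_unindex k).2 (mxtens_unindex k).1.

Definition mat a b (x : 'cV[R]_(b * a)) : 'M[R]_(a, b) :=
  \matrix_(i, j) x (mxtens_index (j, i)) 0.

(* [enum_val] lists the vertices of A in increasing order. *)
Definition clique_mx n (A : {set 'I_n}) : 'M[R]_(#|A|, n) :=
  \matrix_(i, j) (j == enum_val i)%:R.

Definition select_mx n (A : {set 'I_n}) : 'M[R]_(#|A| * #|A|, n * n) :=
  tensmx (clique_mx A) (clique_mx A).

Definition frob a b (A : 'M[R]_(a, b)) : R :=
  Num.sqrt (\sum_i \sum_j A i j ^+ 2).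

(* The point of W nearest to A (unique when W is closed, convex and nonempty);
   the default value A is only taken when no nearest point exists. *)
Definition proj a b (W : set 'M[R]_(a, b)) (A : 'M[R]_(a, b)) : 'M[R]_(a, b) :=
  xget A [set Y | W Y /\ forall Z, W Z -> frob (A - Y) <= frob (A - Z)]%classic.

Definition psd r : set 'M[R]_r :=
  [set A | A^T = A /\ forall x : 'cV[R]_r, 0 <= (x^T *m A *m x) 0 0]%classic.

Definition psd_vec r : set 'cV[R]_(r * r) := [set x | psd (mat x)]%classic.

(* R^(n^2) x S x R^m x R^(n_d) x R_+ , where S is the product of the
   cones [psd_vec #|C k|]. *)
Definition hsde_cone n p (C : 'I_p -> {set 'I_n}) (m : nat) :
    set 'cV[R]_(n * n + (sqdim C + (m + (sqdim C + 1)))) :=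
  [set w | exists (x : 'cV[R]_(n * n))
                  (s : forall k, 'cV[R]_(#|C k| * #|C k|))
                  (y : 'cV[R]_m) (z : 'cV[R]_(sqdim C)) (t : R),
     [/\ forall k, psd_vec (s k), 0 <= t &
      w = col_mx x (col_mx (\mxcol_k s k) (col_mx y (col_mx z t%:M)))]]%classic.

End Matrices.

(* A set is a function type, so automatic implicit arguments would make the
   dimensions implicit. *)
Arguments psd R r _ : clear implicits.
Arguments psd_vec R r _ : clear implicits.
Arguments hsde_cone R {n p} C m _.

(* Computational model: straight-line programs over an append-only memory of
   real numbers (exact arithmetic). A program is fixed independently of the data
   it is run on; operands are memory addresses, so that reading, copying and
   permuting entries (e.g. multiplying by [select_mx A]) is free. *)
Inductive arith := Add | Sub | Mul | Div.

(* [Eigen B] calls the eigenvalue routine on the matrix whose (i, j) entry is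
   stored at address B i j. *)
Inductive instr :=
  | Lit of rat
  | Arith of arith & nat & nat
  | Max0 of nat
  | Eigen (r : nat) of 'M[nat]_r.

Record program (a b : nat) := Program {
  code : seq instr;
  output : 'I_b -> nat
}.

Section Cost.

Variable eigcost : nat -> nat.

Definition instr_flops (c : instr) : nat :=
  match c with
  | Lit _ => 0
  | Arith _ _ _ => 1
  | Max0 _ => 0
  | @Eigen r _ => eigcost r
  end.

Definition flops a b (P : program a b) : nat :=
  (\sum_(c <- code P) instr_flops c)%N.

End Cost.

Section Semantics.

Variable R : realType.
Variable eig : forall r, 'M[R]_r -> 'M[R]_r * 'rV[R]_r.

(* Full eigenvalue decomposition: on a symmetric A, [eig A] = (V, d) with
   V orthogonal and A = V diag(d) V^T. *)
Definition eig_spec : Prop :=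
  forall r (A : 'M[R]_r), A^T = A ->
    (eig A).1^T *m (eig A).1 = 1%:M /\
    A = (eig A).1 *m diag_mx (eig A).2 *m ((eig A).1)^T.

Definition arith_eval (o : arith) (x y : R) : R :=
  match o with
  | Add => x + y
  | Sub => x - y
  | Mul => x * y
  | Div => x / y
  end.

Definition entries a b (A : 'M[R]_(a, b)) : seq R :=
  [seq A i j | i <- enum 'I_a, j <- enum 'I_b].

(* The values appended to the memory s by one instruction; for [Eigen] these
   are the r^2 entries of V, row by row, followed by the r eigenvalues. *)
Definition emit (s : seq R) (c : instr) : seq R :=
  match c with
  | Lit q => [:: ratr q]
  | Arith o i j => [:: arith_eval o s`_i s`_j]
  | Max0 i => [:: Num.max 0 s`_i]
  | @Eigen r B =>
      let Vd := eig (map_mx (fun i : nat => s`_i) B) in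
      entries Vd.1 ++ entries Vd.2
  end.

Definition run (s : seq R) (cs : seq instr) : seq R :=
  foldl (fun s c => s ++ emit s c) s cs.

Definition exec a b (P : program a b) (x : 'cV[R]_a) : 'cV[R]_b :=
  \col_i (run (entries x) (code P))`_(output P i).

End Semantics.

(* Main.v *)
Require Import Defs.
From mathcomp Require Import all_boot all_order all_algebra.
From mathcomp Require Import classical_sets reals mxtens lra zify.

Set Implicit Arguments.
Unset Strict Implicit.
Unset Printing Implicit Defensive.

Import Order.TTheory GRing.Theory Num.Theory.
Local Open Scope ring_scope.

(** Projecting onto each of the cones comes down to projecting every clique
    block onto its own semidefinite cone. The nearest positive semidefinite
    matrix to a square matrix A is obtained from the symmetric part of A: if
    (A + A^T) / 2 = V diag(d) V^T with V orthogonal, it is V diag(max(0, d)) V^T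
    ([proj_psdE]). Symmetrizing is legitimate because the antisymmetric part of
    A is orthogonal to all symmetric matrices, and it is needed because the
    iterates are arbitrary vectors. Optimality and uniqueness both follow from
    the obtuse angle criterion [proj_eq]. The criterion adds up over the factors
    of a product of cones, so the projection in the third step is the identity
    on the free factors, clips the last coordinate at zero, and acts blockwise
    on the semidefinite factors ([proj_hsde_cone]).

    For a clique with r vertices the blocks to be projected are formed with 2
    flops per entry (a / rho, then a difference), since the selection matrices
    only pick entries. Symmetrizing takes 2 more flops per entry, the
    eigenvalue routine at most c r^3, and each entry of V diag(max(0, d)) V^T is
    a sum of r products of three factors, hence 3 r flops. As r^2 <= r^3, the
    total is at most (c + 7) r^3 per clique ([attains_psd_parts]). Dividing every
    entry by rho, rather than computing 1 / rho once, makes the count vanish when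
    the only clique is empty, as the bound then requires.

    Programs are never written out. The statement [attains c P Q] says that
    whatever code satisfies P can be prolonged by at most c flops so as to
    satisfy Q; as the memory only grows, a value once computed stays available,
    and such statements compose by adding costs. *)

(** * Obtuse angle criterion for projections *)

Section Geometry.

Variable R : realType.

Definition dotmx a b (A B : 'M[R]_(a, b)) : R := \tr (A^T *m B).

Lemma dotmxE a b (A B : 'M[R]_(a, b)) :
  dotmx A B = \sum_i \sum_j A i j * B i j.
Proof.
rewrite exchange_big /=; apply: eq_bigr => j _; rewrite mxE.
by apply: eq_bigr => i _; rewrite mxE.
Qed.

Lemma dotmxBl a b (A B C : 'M[R]_(a, b)) :
  dotmx (A - B) C = dotmx A C - dotmx B C.
Proof. by rewrite /dotmx linearB mulmxBl linearB. Qed.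

Lemma dotmxBr a b (A B C : 'M[R]_(a, b)) :
  dotmx A (B - C) = dotmx A B - dotmx A C.
Proof. by rewrite /dotmx mulmxBr linearB. Qed.

Lemma dotmxC a b (A B : 'M[R]_(a, b)) : dotmx A B = dotmx B A.
Proof. by rewrite /dotmx -mxtrace_tr trmx_mul trmxK. Qed.

Lemma dotmx_tr a b (A B : 'M[R]_(a, b)) : dotmx A^T B^T = dotmx A B.
Proof. by rewrite /dotmx trmxK mxtrace_mulC -/(dotmx B A) dotmxC. Qed.

Lemma dotmx_col_mx a1 a2 b (A1 B1 : 'M[R]_(a1, b)) (A2 B2 : 'M[R]_(a2, b)) :
  dotmx (col_mx A1 A2) (col_mx B1 B2) = dotmx A1 B1 + dotmx A2 B2.
Proof. by rewrite /dotmx tr_col_mx mul_row_col mxtraceD. Qed.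

Lemma dotmx_mxcol p (q : 'I_p -> nat) b (A B : forall k, 'M[R]_(q k, b)) :
  dotmx (\mxcol_k A k) (\mxcol_k B k) = \sum_k dotmx (A k) (B k).
Proof.
by rewrite /dotmx tr_mxcol mul_mxrow_mxcol linear_sum.
Qed.

Lemma dotmx_ge0 a b (A : 'M[R]_(a, b)) : 0 <= dotmx A A.
Proof.
rewrite dotmxE; apply: sumr_ge0 => i _; apply: sumr_ge0 => j _.
by rewrite -expr2 sqr_ge0.
Qed.

Lemma dotmx_eq0 a b (A : 'M[R]_(a, b)) : dotmx A A <= 0 -> A = 0.
Proof.
move=> A0; apply/matrixP => i j; rewrite mxE; apply/eqP.
have {A0} : dotmx A A == 0 by rewrite eq_le A0 dotmx_ge0.
have sq k l : 0 <= A k l * A k l by rewrite -expr2 sqr_ge0.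
rewrite dotmxE psumr_eq0; last by move=> k _; apply: sumr_ge0.
move=> /allP /(_ i (mem_index_enum _)) /=.
rewrite psumr_eq0 // => /allP /(_ j (mem_index_enum _)) /=.
by rewrite mulf_eq0 orbb.
Qed.

Lemma frobE a b (A : 'M[R]_(a, b)) : frob A = Num.sqrt (dotmx A A).
Proof. by rewrite dotmxE. Qed.

(** If Y makes an obtuse angle with every point Z of W, then
    |A - Z|^2 >= |A - Y|^2 + |Z - Y|^2, so that Y is nearest and any other
    nearest point coincides with it. *)
Lemma proj_eq a b (W : set 'M[R]_(a, b)) (A Y : 'M[R]_(a, b)) :
  W Y -> (forall Z, W Z -> dotmx (A - Y) (Z - Y) <= 0) -> proj W A = Y.
Proof.
move=> WY obtuse.
have pyth Z : W Z ->
    dotmx (A - Y) (A - Y) + dotmx (Z - Y) (Z - Y) <= dotmx (A - Z) (A - Z).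
  move=> /obtuse; rewrite !dotmxBl !dotmxBr (dotmxC Y A) (dotmxC Z A).
  by rewrite (dotmxC Y Z); lra.
apply: xget_unique => [|Z [WZ Zmin]].
  split=> // Z /pyth le; rewrite !frobE ler_wsqrtr //.
  by apply: le_trans le; rewrite lerDl dotmx_ge0.
have := Zmin _ WY; rewrite !frobE ler_sqrt ?dotmx_ge0 // => le.
by apply/eqP; rewrite -subr_eq0; apply/eqP/dotmx_eq0; have := pyth _ WZ; lra.
Qed.

(** * Nearest positive semidefinite matrix *)

Definition sympart r (A : 'M[R]_r) : 'M[R]_r :=
  \matrix_(i, j) ((A i j + A j i) / 2).

Lemma sympart_sym r (A : 'M[R]_r) : (sympart A)^T = sympart A.
Proof. by apply/matrixP => i j; rewrite !mxE addrC. Qed.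

(** The antisymmetric part of A is orthogonal to every symmetric matrix. *)
Lemma dotmx_sympart r (A B : 'M[R]_r) :
  B^T = B -> dotmx (sympart A) B = dotmx A B.
Proof.
move=> symB; have -> : sympart A = 2^-1 *: (A + A^T).
  by apply/matrixP => i j; rewrite !mxE mulrC.
rewrite /dotmx linearZ /= -scalemxAl mxtraceZ linearD /= mulmxDl mxtraceD.
have -> : \tr (A^T^T *m B) = \tr (A^T *m B).
  by rewrite -{1}symB -/(dotmx _ _) dotmx_tr.
lra.
Qed.

Definition spectral r (Vd : 'M[R]_r * 'rV[R]_r) : 'M[R]_r :=
  Vd.1 *m diag_mx Vd.2 *m Vd.1^T.

Definition pospart r (d : 'rV[R]_r) : 'rV[R]_r := map_mx (Num.max 0) d.

Lemma spectralE r (V : 'M[R]_r) d i j :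
  spectral (V, d) i j = \sum_k V i k * d 0 k * V j k.
Proof.
rewrite mxE; apply: eq_bigr => k _; rewrite !mxE; congr (_ * _).
rewrite (bigD1 k) //= mxE eqxx mulr1n big1 ?addr0 // => l /negPf lk.
by rewrite mxE lk mulr0n mulr0.
Qed.

Lemma dotmx_spectral r (V Z : 'M[R]_r) d :
  dotmx (spectral (V, d)) Z = \sum_k d 0 k * (V^T *m Z *m V) k k.
Proof.
rewrite /dotmx /spectral /= !trmx_mul trmxK tr_diag_mx -!mulmxA mxtrace_mulC.
rewrite -!mulmxA /mxtrace; apply: eq_bigr => k _.
by rewrite mul_diag_mx mxE.
Qed.

(** The k-th diagonal entry is the quadratic form of Z at the k-th column of V. *)
Lemma psd_diag r (V Z : 'M[R]_r) k : psd R r Z -> 0 <= (V^T *m Z *m V) k k.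
Proof.
case=> _ /(_ (col k V)); congr (0 <= _).
by rewrite tr_col -row_mul mxE [RHS]mxE; apply: eq_bigr => j _; rewrite !mxE.
Qed.

Lemma spectral_sym r (V : 'M[R]_r) d : (spectral (V, d))^T = spectral (V, d).
Proof. by rewrite /spectral !trmx_mul trmxK tr_diag_mx mulmxA. Qed.

(** For u = V^T x, the quadratic form at x is the sum of the d_k u_k^2. *)
Lemma psd_spectral r (V : 'M[R]_r) (d : 'rV[R]_r) :
  (forall k, 0 <= d 0 k) -> psd R r (spectral (V, d)).
Proof.
move=> d0; split=> [|x]; first exact: spectral_sym.
have -> : (x^T *m spectral (V, d) *m x) 0 0 = dotmx (spectral (V, d)) (x *m x^T).
  rewrite /dotmx spectral_sym; move: (spectral _) => S.
  by rewrite mulmxA mxtrace_mulC mulmxA trace_mx11.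
rewrite dotmx_spectral; apply: sumr_ge0 => k _; rewrite mulr_ge0 //.
have -> : V^T *m (x *m x^T) *m V = (V^T *m x) *m (V^T *m x)^T.
  by rewrite trmx_mul trmxK !mulmxA.
by rewrite mxE big_ord1 [X in _ * X]mxE -expr2 sqr_ge0.
Qed.

Lemma spectralB r (V : 'M[R]_r) d1 d2 :
  spectral (V, d1) - spectral (V, d2) = spectral (V, d1 - d2).
Proof. by rewrite /spectral linearB /= mulmxBr mulmxBl. Qed.

(** With Y = V diag(d+) V^T, the difference of the symmetric part of A and Y
    is V diag(d - d+) V^T. Its product with Y vanishes because (d - d+) d+ = 0,
    and its product with Z is nonpositive because d - d+ <= 0 while V^T Z V has a
    nonnegative diagonal. *)
Lemma obtuse_psd r (A V Z : 'M[R]_r) d :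
  V^T *m V = 1%:M -> sympart A = spectral (V, d) -> psd R r Z ->
  dotmx (A - spectral (V, pospart d)) (Z - spectral (V, pospart d)) <= 0.
Proof.
move=> orthV eqA psdZ; set Y := spectral (V, pospart d).
have symZY : (Z - Y)^T = Z - Y by rewrite linearB /= spectral_sym (proj1 psdZ).
rewrite dotmxBl -(dotmx_sympart A symZY) -dotmxBl eqA spectralB dotmx_spectral.
apply: sumr_le0 => k _.
have -> : V^T *m (Z - Y) *m V = V^T *m Z *m V - diag_mx (pospart d).
  rewrite mulmxBr mulmxBl; congr (_ - _).
  by rewrite !mulmxA orthV mul1mx -mulmxA orthV mulmx1.
have := psd_diag V k psdZ; set z := (V^T *m Z *m V).
rewrite !mxE eqxx mulr1n; move: (z k k) (d 0 k) => a b a0.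
have [b0|b0] := leP 0 b; last by rewrite !subr0 mulr_le0_ge0 // ltW.
by rewrite subrr mul0r.
Qed.

Lemma proj_psdE r (A V : 'M[R]_r) d :
  V^T *m V = 1%:M -> sympart A = spectral (V, d) ->
  proj (psd R r) A = spectral (V, pospart d).
Proof.
move=> orthV eqA; apply: proj_eq => [|Z]; last exact: obtuse_psd.
by apply: psd_spectral => k; rewrite mxE le_max lexx.
Qed.

(** * Vectorization and selection of clique entries *)

Lemma vecK a b (A : 'M[R]_(a, b)) : mat (vec A) = A.
Proof. by apply/matrixP => i j; rewrite !mxE mxtens_indexK. Qed.

Lemma dotmx_mat a b (x y : 'cV[R]_(b * a)) : dotmx (mat x) (mat y) = dotmx x y.
Proof.
rewrite !dotmxE exchange_big pair_big /=.
rewrite [RHS](reindex (@mxtens_index b a)) /=; last first.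
  by exists (@mxtens_unindex b a) => i _;
    [exact: mxtens_indexK | exact: mxtens_unindexK].
by apply: eq_bigr => -[j i] _; rewrite big_ord1 !mxE.
Qed.

Lemma select_mxE n (A : {set 'I_n}) (x : 'cV[R]_(n * n)) i j :
  (select_mx R A *m x) (mxtens_index (i, j)) 0 =
  x (mxtens_index (enum_val i, enum_val j)) 0.
Proof.
rewrite mxE (bigD1 (mxtens_index (enum_val i, enum_val j))) //=.
rewrite tensmxE !mxE !eqxx !mul1r big1 ?addr0 // => k.
case: (mxtens_indexP k) => k1 k2 ne; rewrite tensmxE !mxE -natrM mulnb.
case: eqP => [e1|]; last by rewrite mul0r.
by case: eqP => [e2|]; rewrite ?mul0r //; rewrite e1 e2 eqxx in ne.
Qed.

(** * Projection onto the cone of the self-dual embedding *)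

Section HsdeCone.

Variables (n p : nat) (C : 'I_p -> {set 'I_n}) (m : nat).
Variable eig : forall r, 'M[R]_r -> 'M[R]_r * 'rV[R]_r.
Arguments eig {r}.
Hypothesis eigP : eig_spec (@eig).

Definition psd_part r (A : 'M[R]_r) : 'M[R]_r :=
  spectral ((eig (sympart A)).1, pospart (eig (sympart A)).2).

Lemma proj_psd r (A : 'M[R]_r) : proj (psd R r) A = psd_part A.
Proof.
have [orthV eqA] := eigP (sympart_sym A).
exact: proj_psdE.
Qed.

(** The inner product is additive over blocks, so the obtuse angle criterion can be
    checked factor by factor; the free factors contribute nothing. *)
Lemma proj_hsde_cone x (s : forall k, 'cV[R]_(#|C k| * #|C k|)) y z t :
  proj (hsde_cone R C m)
    (col_mx x (col_mx (\mxcol_k s k) (col_mx y (col_mx z t%:M)))) =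
  col_mx x (col_mx (\mxcol_k vec (psd_part (mat (s k))))
    (col_mx y (col_mx z (Num.max 0 t)%:M))).
Proof.
apply: proj_eq.
  exists x, (fun k => vec (psd_part (mat (s k)))), y, z, (Num.max 0 t).
  split=> // [k|]; last by rewrite le_max lexx.
  by rewrite /psd_vec /= vecK; apply: psd_spectral => i; rewrite mxE le_max lexx.
move=> _ [x' [s' [y' [z' [t' [psds' t'0 ->]]]]]].
rewrite !opp_col_mx !add_col_mx !dotmx_col_mx !subrr.
have dot0 a (B : 'cV[R]_a) : dotmx 0 B = 0.
  by rewrite /dotmx trmx0 mul0mx mxtrace0.
rewrite !dot0 !add0r -!mxcolB dotmx_mxcol.
rewrite -[leRHS]addr0 lerD //.
  apply: sumr_le0 => k _; rewrite -dotmx_mat.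
  have matB u v : mat (u - v) = mat u - mat v :> 'M[R]_#|C k|.
    by apply/matrixP => i j; rewrite !mxE.
  rewrite !matB vecK.
  have [orthV eqA] := eigP (sympart_sym (mat (s k))).
  exact: obtuse_psd (psds' k).
rewrite -!raddfB dotmxE !big_ord1 !mxE !mulr1n.
by have [t0|t0] := leP 0 t; [rewrite subrr mul0r | nra].
Qed.

End HsdeCone.

End Geometry.

(** * A cost calculus for straight-line programs *)

Section Programs.

Variables (eigcost : nat -> nat) (R : realType).
Variable eig : forall r, 'M[R]_r -> 'M[R]_r * 'rV[R]_r.
Variable N : nat.
Arguments eig {r}.

Local Notation code := (seq instr).
Local Notation input := 'cV[R]_N.

Definition code_flops (cs : code) : nat :=
  (\sum_(c <- cs) instr_flops eigcost c)%N.

Definition memory (cs : code) (w : input) : seq R := run (@eig) (entries w) cs.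

(** The address must not depend on the input, since it is going to be hard-wired in
    the operands of later instructions. *)
Definition available (f : input -> R) (cs : code) : Prop :=
  exists l, forall w, (l < size (memory cs w))%N /\ (memory cs w)`_l = f w.

Definition available_mx a b (F : input -> 'M[R]_(a, b)) (cs : code) : Prop :=
  forall i j, available (fun w => F w i j) cs.
#[global] Arguments available_mx {a b} F cs.

Definition input_available : code -> Prop := available_mx (fun w : input => w).

Lemma available_ext cs f g : f =1 g -> available f cs -> available g cs.
Proof. by move=> fg [l lP]; exists l => w; rewrite -fg. Qed.

(** A Hoare triple with a cost, for assertions about the code written so far. The
    assertions of interest are conjunctions of availability statements. *)
Definition attains (c : nat) (P Q : code -> Prop) : Prop :=
  forall cs, P cs -> exists2 t, (code_flops t <= c)%N & Q (cs ++ t).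

Definition stable (P : code -> Prop) : Prop := forall cs t, P cs -> P (cs ++ t).

Lemma memory_cat cs t w : memory (cs ++ t) w = run (@eig) (memory cs w) t.
Proof. by rewrite /memory /run foldl_cat. Qed.

Lemma run_extends (s : seq R) cs : exists u, run (@eig) s cs = s ++ u.
Proof.
elim: cs s => [|c cs IH] s /=; first by exists [::]; rewrite cats0.
by have [u ->] := IH (s ++ emit (@eig) s c); rewrite -catA; eexists.
Qed.

Lemma stable_available f : stable (available f).
Proof.
move=> cs t [l lP]; exists l => w; have [lt <-] := lP w.
rewrite memory_cat; have [u ->] := run_extends (memory cs w) t.
by rewrite size_cat nth_cat lt ltn_addr.
Qed.

Lemma stable_available_mx a b (F : input -> 'M[R]_(a, b)) :
  stable (available_mx F).
Proof. by move=> cs t av i j; apply: stable_available. Qed.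
#[global] Arguments stable_available_mx {a b} F.

Lemma available_col_mx a1 a2 b (F1 : input -> 'M[R]_(a1, b))
    (F2 : input -> 'M[R]_(a2, b)) cs :
  available_mx F1 cs -> available_mx F2 cs ->
  available_mx (fun w => col_mx (F1 w) (F2 w)) cs.
Proof.
move=> av1 av2 i j; case: (split_ordP i) => k ->.
  by apply: available_ext (av1 k j) => w; rewrite col_mxEu.
by apply: available_ext (av2 k j) => w; rewrite col_mxEd.
Qed.

Lemma size_entries a b (A : 'M[R]_(a, b)) : size (entries A) = (a * b)%N.
Proof. by rewrite size_allpairs !size_enum_ord. Qed.

Lemma entries_address a b (i : 'I_a) (j : 'I_b) :
  exists2 l, (l < a * b)%N & forall A : 'M[R]_(a, b), (entries A)`_l = A i j.
Proof.
set pairs := [seq (i, j) | i <- enum 'I_a, j <- enum 'I_b].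
have inp : (i, j) \in pairs by rewrite allpairs_f ?mem_enum.
have szp : size pairs = (a * b)%N by rewrite size_allpairs !size_enum_ord.
exists (index (i, j) pairs) => [|A]; first by rewrite -szp index_mem.
have -> : entries A = [seq A ij.1 ij.2 | ij <- pairs].
  by rewrite map_allpairs.
by rewrite (nth_map (i, j)) ?index_mem // nth_index.
Qed.

(** The memory size, hence the address of the next value to be written, is determined
    by the code alone. *)
Lemma size_run (s1 s2 : seq R) cs :
  size s1 = size s2 -> size (run (@eig) s1 cs) = size (run (@eig) s2 cs).
Proof.
elim: cs s1 s2 => [|c cs IH] s1 s2 sz //=; apply: IH.
rewrite 2!size_cat sz; congr addn.
by case: c => [q|o i j|i|r B]; rewrite //= !size_cat !size_entries.
Qed.

Lemma available_emit cs c k f :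
  (forall w, (k < size (emit (@eig) (memory cs w) c))%N /\
             (emit (@eig) (memory cs w) c)`_k = f w) ->
  available f (cs ++ [:: c]).
Proof.
move=> cP; exists (size (memory cs 0) + k)%N => w.
have -> : size (memory cs 0) = size (memory cs w).
  by apply: size_run; rewrite !size_entries.
rewrite memory_cat /= size_cat ltn_add2l nth_cat.
rewrite [X in if X then _ else _]ltnNge leq_addr /= addKn.
exact: cP.
Qed.

Lemma attains_trans c d (P Q S : code -> Prop) :
  attains c P Q -> attains d Q S -> attains (c + d) P S.
Proof.
move=> PQ QS cs /PQ [t le_t /QS [u le_u Su]]; exists (t ++ u).
  by rewrite /code_flops big_cat leq_add.
by rewrite catA.
Qed.

Lemma attains_and c d (P Q S : code -> Prop) :
  stable P -> stable Q -> attains c P Q -> attains d P S ->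
  attains (c + d) P (fun cs => [/\ P cs, Q cs & S cs]).
Proof.
move=> stP stQ PQ PS cs Pcs; have [t le_t Qt] := PQ cs Pcs.
have [u le_u Su] := PS _ (stP _ t Pcs); exists (t ++ u).
  by rewrite /code_flops big_cat leq_add.
by rewrite catA; split=> //; [apply/stP/stP | apply: stQ].
Qed.

Lemma attains_weak c d (P P' Q Q' : code -> Prop) :
  (forall cs, P' cs -> P cs) -> (forall cs, Q cs -> Q' cs) -> (c <= d)%N ->
  attains c P Q -> attains d P' Q'.
Proof.
move=> P'P QQ' le_cd PQ cs /P'P /PQ [t le_t /QQ' Qt].
by exists t => //; apply: leq_trans le_cd.
Qed.

(** The tasks are carried out one after the other; stability of P keeps it true when
    a later task starts, and stability of Q keeps the earlier results. *)
Lemma attains_all (T : finType) (c : T -> nat) (P : code -> Prop)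
    (Q : T -> code -> Prop) :
  stable P -> (forall x, stable (Q x)) -> (forall x, attains (c x) P (Q x)) ->
  attains (\sum_x c x) P (fun cs => forall x, Q x cs).
Proof.
move=> stP stQ PQ.
suff IH (s : seq T) :
    attains (\sum_(x <- s) c x) P (fun cs => forall x, x \in s -> Q x cs).
  apply: attains_weak (leqnn _) (IH (index_enum T)) => // cs all x.
  exact/all/mem_index_enum.
elim: s => [|x s IH] cs Pcs; first by exists [::]; rewrite ?/code_flops ?big_nil.
have [t le_t Qt] := PQ x cs Pcs; have [u le_u Qu] := IH _ (stP _ t Pcs).
exists (t ++ u); first by rewrite /code_flops big_cat big_cons leq_add.
by rewrite catA => y /[!inE] /predU1P [->|/Qu //]; apply: stQ.
Qed.

Lemma attains_lit (P : code -> Prop) q :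
  attains 0 P (available (fun=> ratr q)).
Proof.
move=> cs _; exists [:: Lit q]; first by rewrite /code_flops big_seq1.
by apply: (available_emit (k := 0)).
Qed.

Lemma attains_known (P : code -> Prop) f :
  (forall cs, P cs -> available f cs) -> attains 0 P (available f).
Proof.
move=> known cs /known av; exists [::]; last by rewrite cats0.
by rewrite /code_flops big_nil.
Qed.

Lemma attains_ext c (P : code -> Prop) f g :
  f =1 g -> attains c P (available f) -> attains c P (available g).
Proof. by move=> fg; apply: attains_weak => // cs; apply: available_ext. Qed.

Lemma attains_arith o c d (P : code -> Prop) f g :
  stable P -> attains c P (available f) -> attains d P (available g) ->
  attains (c + d).+1 P (available (fun w => arith_eval o (f w) (g w))).
Proof.
move=> stP Pf Pg cs Pcs.
have [t le_t avf] := Pf cs Pcs.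
have [u le_u [l' l'P]] := Pg _ (stP _ t Pcs).
have [l lP] := stable_available u avf.
exists (t ++ u ++ [:: Arith o l l']).
  by rewrite /code_flops !big_cat big_seq1 /= addnA addn1 ltnS leq_add.
rewrite !catA; apply: (available_emit (k := 0)) => w.
by rewrite /= (lP w).2 (l'P w).2.
Qed.

Lemma attains_max0 c (P : code -> Prop) f :
  attains c P (available f) -> attains c P (available (fun w => Num.max 0 (f w))).
Proof.
move=> Pf cs /Pf [t le_t [l lP]]; exists (t ++ [:: Max0 l]).
  by rewrite /code_flops big_cat big_seq1 /= addn0.
by rewrite catA; apply: (available_emit (k := 0)) => w; rewrite /= (lP w).2.
Qed.

Lemma attains_eigen r (A : input -> 'M[R]_r) :
  attains (eigcost r) (available_mx A)
    (fun cs => available_mx (fun w => (eig (A w)).1) cs /\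
               available_mx (fun w => (eig (A w)).2) cs).
Proof.
move=> cs avA.
have [B BP] : exists B : 'I_r * 'I_r -> nat, forall ij w,
    (memory cs w)`_(B ij) = A w ij.1 ij.2.
  apply: (fin_all_exists
    (P := fun ij l => forall w, (memory cs w)`_l = A w ij.1 ij.2)) => -[i j].
  by have [l lP] := avA i j; exists l => w; case: (lP w).
pose c := Eigen (\matrix_(i, j) B (i, j)).
have emitE w : emit (@eig) (memory cs w) c =
    entries (eig (A w)).1 ++ entries (eig (A w)).2.
  rewrite /=; suff -> : map_mx (nth 0 (memory cs w)) (\matrix_(i, j) B (i, j))
     = A w by [].
  by apply/matrixP => i j; rewrite !mxE BP.
exists [:: c]; first by rewrite /code_flops big_seq1.
split=> i j; have [l lt lP] := entries_address i j.
  apply: (available_emit (k := l)) => w.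
  by rewrite emitE size_cat nth_cat !size_entries lt ltn_addr.
apply: (available_emit (k := r * r + l)) => w.
rewrite emitE size_cat nth_cat !size_entries ltn_add2l lt.
by rewrite [X in if X then _ else _]ltnNge leq_addr /= addKn.
Qed.
#[global] Arguments attains_eigen {r} A.

(** The sum is accumulated from the literal 0, so #|T| terms take #|T| additions. *)
Lemma attains_sum (T : finType) c (P : code -> Prop) (f : T -> input -> R) :
  stable P -> (forall x, attains c P (available (f x))) ->
  attains (#|T| * c.+1) P (available (fun w => \sum_x f x w)).
Proof.
move=> stP Pf.
have -> : #|T| = size (index_enum T).
  by rewrite -sum1_card -sum1_size; apply: eq_bigl.
elim: (index_enum T) => [|x s IH].
  by apply: attains_ext (attains_lit 0) => w; rewrite big_nil rmorph0.
rewrite /= mulSn addSn; apply: attains_ext (attains_arith Add stP (Pf x) IH) => w.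
by rewrite big_cons.
Qed.

Lemma attains_mx a b c (P : code -> Prop) (F : input -> 'M[R]_(a, b)) :
  stable P -> (forall i j, attains c P (available (fun w => F w i j))) ->
  attains (a * b * c) P (available_mx F).
Proof.
move=> stP PF.
have -> : (a * b * c)%N = (\sum_(i < a) \sum_(j < b) c)%N.
  by rewrite !sum_nat_const !card_ord mulnA.
apply: attains_all => [//|i|i]; first by move=> cs t av j; apply: stable_available.
by apply: attains_all => [//|j|j]; first exact: stable_available.
Qed.

Lemma attains_exec b c (F : input -> 'cV[R]_b) :
  attains c input_available (available_mx F) ->
  exists2 P : program N b, (flops eigcost P <= c)%N &
    forall w, exec (@eig) P w = F w.
Proof.
move=> /(_ [::]) [i j|cs le_cs avF].
  have [l lt lP] := entries_address i j.
  by exists l => w; rewrite /memory /= size_entries.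
have [out outP] : exists out : 'I_b -> nat, forall i w,
    (memory cs w)`_(out i) = F w i 0.
  apply: (fin_all_exists
    (P := fun i l => forall w, (memory cs w)`_l = F w i 0)) => i.
  by have [l lP] := avF i 0; exists l => w; case: (lP w).
exists (Program N cs out) => // w.
by apply/matrixP => i j; rewrite mxE outP ord1.
Qed.

(** * Flop count of the projection onto products of semidefinite cones *)

Lemma attains_sympart r (A : input -> 'M[R]_r) :
  attains (r * r * 2) (available_mx A) (available_mx (fun w => sympart (A w))).
Proof.
have stA := stable_available_mx A; apply: attains_mx => // i j.
pose f w := arith_eval Div (arith_eval Add (A w i j) (A w j i)) (ratr 2).
apply: (attains_ext (f := f)) => [w|]; first by rewrite mxE -(ratr_nat R 2).
apply: (attains_arith Div (c := 1) (d := 0)) => //; last exact: attains_lit.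
by apply: (attains_arith Add (c := 0) (d := 0)) => //; apply: attains_known.
Qed.
#[global] Arguments attains_sympart {r} A.

(** Each of the r^2 entries is a sum of r terms, and each term costs two
    multiplications and one addition. *)
Lemma attains_spectral r (V : input -> 'M[R]_r) (d : input -> 'rV[R]_r) :
  attains (r * r * (r * 3)) (fun cs => available_mx V cs /\ available_mx d cs)
    (available_mx (fun w => spectral (V w, pospart (d w)))).
Proof.
set P := fun cs => _.
have stP : stable P by move=> cs t [? ?]; split; apply: stable_available_mx.
apply: attains_mx => // i j; rewrite -[in X in attains X](card_ord r).
pose f k w := arith_eval Mul (arith_eval Mul (V w i k) (Num.max 0 (d w 0 k)))
  (V w j k).
apply: (attains_ext (f := fun w => \sum_k f k w)) => [w|].
  by rewrite spectralE; apply: eq_bigr => k _; rewrite mxE.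
apply: attains_sum => // k.
apply: (attains_arith Mul (c := 1) (d := 0)) => //.
  apply: (attains_arith Mul (c := 0) (d := 0)) => //.
    by apply: attains_known => cs [avV _]; apply: avV.
  by apply/attains_max0/attains_known => cs [_ avd]; apply: avd.
by apply: attains_known => cs [avV _]; apply: avV.
Qed.
#[global] Arguments attains_spectral {r} V d.

Lemma attains_psd_part r (A : input -> 'M[R]_r) :
  attains (r * r * 2 + (eigcost r + r * r * (r * 3))) (available_mx A)
    (available_mx (fun w => psd_part (@eig) (A w))).
Proof.
apply: attains_trans (attains_sympart A) _.
exact: attains_trans (attains_eigen _) (attains_spectral _ _).
Qed.
#[global] Arguments attains_psd_part {r} A.

(** The three terms of [attains_psd_part] are at most 2 r^3, K r^3 and 3 r^3, and
    the entries of A cost another 2 r^2. *)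
Lemma attains_psd_parts p (q : 'I_p -> nat)
    (A : forall k, input -> 'M[R]_(q k)) (P : code -> Prop) K :
  (forall r, eigcost r <= K * r ^ 3)%N -> stable P ->
  (forall k i j, attains 2 P (available (fun w => A k w i j))) ->
  attains ((K + 7) * \sum_k q k ^ 3) P
    (available_mx (fun w => \mxcol_k vec (psd_part (@eig) (A k w)))).
Proof.
move=> le_eig stP PA; rewrite big_distrr /=.
pose Q k := available_mx (fun w => psd_part (@eig) (A k w)).
apply: (@attains_weak _ _ P P (fun cs => forall k, Q k cs)) (leqnn _) _ => //.
  move=> cs av i j; apply: available_ext (av (tagnat.sig1 i) _ _) => w.
  by rewrite !mxE.
apply: attains_all => // k; first exact: stable_available_mx.
apply: attains_weak
  (attains_trans (attains_mx stP (PA k)) (attains_psd_part (A k))) => //.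
by have := le_eig (q k); nia.
Qed.

End Programs.

(** * The three projection steps *)

Theorem proposition3 (eigcost : nat -> nat)
  (Hcost : exists c : nat, forall r : nat, (eigcost r <= c * r ^ 3)%N) :
  exists K : nat,
  forall (R : realType) (eig : forall r : nat, 'M[R]_r -> 'M[R]_r * 'rV[R]_r)
         (n : nat) (e : rel 'I_n) (p : nat) (C : 'I_p -> {set 'I_n}) (m : nat),
  eig_spec eig ->
  simple_graph e -> chordal e -> enumerates_maximal_cliques e C ->
  (0 < m)%N ->
  [/\ exists2 P : program (1 + (n * n + sqdim C)) (sqdim C),
        (flops eigcost P <= K * \sum_(k < p) #|C k| ^ 3)%N &
        forall (rho : R) (x : 'cV[R]_(n * n))
               (lam : forall k : 'I_p, 'cV[R]_(#|C k| * #|C k|)),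
          0 < rho ->
          exec eig P (col_mx rho%:M (col_mx x (\mxcol_k lam k))) =
          \mxcol_k vec (proj (psd R #|C k|)
            (mat (select_mx R (C k) *m x - rho^-1 *: lam k))),
      exists2 P : program (1 + (sqdim C + sqdim C)) (sqdim C),
        (flops eigcost P <= K * \sum_(k < p) #|C k| ^ 3)%N &
        forall (rho : R) (v lam : forall k : 'I_p, 'cV[R]_(#|C k| * #|C k|)),
          0 < rho ->
          exec eig P (col_mx rho%:M (col_mx (\mxcol_k v k) (\mxcol_k lam k))) =
          \mxcol_k vec (proj (psd R #|C k|) (mat (v k - rho^-1 *: lam k)))
    & exists2 P : program (n * n + (sqdim C + (m + (sqdim C + 1))))
                          (n * n + (sqdim C + (m + (sqdim C + 1)))),
        (flops eigcost P <= K * \sum_(k < p) #|C k| ^ 3)%N &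
        forall uhat v : 'cV[R]_(n * n + (sqdim C + (m + (sqdim C + 1)))),
          exec eig P (uhat - v) = proj (hsde_cone R C m) (uhat - v)].
Proof.
have [c le_eig] := Hcost; exists (c + 7)%N => R eig n e p C m eigP _ _ _ _.
have stX N : stable (input_available eig N) := stable_available_mx _.
have known N k l : attains eigcost 0 (input_available eig N)
    (available eig (fun w : 'cV[R]_N => w k l)).
  by apply: attains_known => cs; apply.
(* Entrywise division: computing 1 / rho beforehand would cost one flop even
   when there is no entry. *)
have diff N (rho a b : 'I_N) :
    attains eigcost 2 (input_available eig N)
      (available eig (fun w : 'cV[R]_N => w a 0 - w b 0 / w rho 0)).
  pose f (w : 'cV[R]_N) :=
    arith_eval Defs.Sub (w a 0) (arith_eval Div (w b 0) (w rho 0)).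
  apply: (attains_ext (f := f)) => //.
  apply: (attains_arith Defs.Sub (c := 0) (d := 1)) => //.
  exact: (attains_arith Div (c := 0) (d := 0)).
pose blk k a : 'I_(sqdim C) := @tagnat.Rank p (fun k => #|C k| * #|C k|)%N k a.
split.
- pose N := (1 + (n * n + sqdim C))%N.
  pose F k (w : 'cV[R]_N) : 'M[R]_#|C k| :=
    mat (select_mx R (C k) *m usubmx (dsubmx w)
         - (w (lshift _ 0) 0)^-1 *: submxcol (dsubmx (dsubmx w)) k).
  have FP k i j : attains eigcost 2 (input_available eig N)
      (available eig (fun w => F k w i j)).
    apply: (attains_ext _ (diff N (lshift _ 0)
      (rshift 1 (lshift _ (mxtens_index (enum_val j, enum_val i))))
      (rshift 1 (rshift _ (blk k (mxtens_index (j, i))))))) => w.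
    by rewrite mxE mxE select_mxE !mxE mulrC.
  have [P le_P PE] := attains_exec (attains_psd_parts le_eig (stX N) FP).
  exists P => // rho x lam _; rewrite PE; apply: eq_mxcol => k.
  rewrite (proj_psd eigP) /F col_mxEu mxE mulr1n !col_mxKd col_mxKu.
  by rewrite mxcolK.
- pose N := (1 + (sqdim C + sqdim C))%N.
  pose F k (w : 'cV[R]_N) : 'M[R]_#|C k| :=
    mat (submxcol (usubmx (dsubmx w)) k
         - (w (lshift _ 0) 0)^-1 *: submxcol (dsubmx (dsubmx w)) k).
  have FP k i j : attains eigcost 2 (input_available eig N)
      (available eig (fun w => F k w i j)).
    apply: (attains_ext _ (diff N (lshift _ 0)
      (rshift 1 (lshift _ (blk k (mxtens_index (j, i)))))
      (rshift 1 (rshift _ (blk k (mxtens_index (j, i))))))) => w.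
    by rewrite !mxE mulrC.
  have [P le_P PE] := attains_exec (attains_psd_parts le_eig (stX N) FP).
  exists P => // rho v lam _; rewrite PE; apply: eq_mxcol => k.
  rewrite (proj_psd eigP) /F col_mxEu mxE mulr1n !col_mxKd col_mxKu.
  by rewrite !mxcolK.
- set N := (n * n + _)%N.
  pose s (w : 'cV[R]_N) k : 'cV[R]_(#|C k| * #|C k|) :=
    submxcol (usubmx (dsubmx w)) k.
  pose y (w : 'cV[R]_N) : 'cV[R]_m := usubmx (dsubmx (dsubmx w)).
  pose z (w : 'cV[R]_N) : 'cV[R]_(sqdim C) :=
    usubmx (dsubmx (dsubmx (dsubmx w))).
  pose t (w : 'cV[R]_N) : R := dsubmx (dsubmx (dsubmx (dsubmx w))) 0 0.
  have wE w : w = col_mx (usubmx w) (col_mx (\mxcol_k s w k)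
      (col_mx (y w) (col_mx (z w) (t w)%:M))).
    by rewrite submxcolK -mx11_scalar !vsubmxK.
  pose F k (w : 'cV[R]_N) : 'M[R]_#|C k| := mat (s w k).
  (* The blocks are read off the input; 2 is the uniform allowance per entry. *)
  have FP k i j : attains eigcost 2 (input_available eig N)
      (available eig (fun w => F k w i j)).
    apply: attains_weak (known N _ 0) => // cs.
    by apply: available_ext => w; rewrite !mxE.
  have sP := attains_psd_parts le_eig (stX N) FP.
  have tP : attains eigcost 0 (input_available eig N)
      (available eig (fun w => Num.max 0 (t w))).
    apply: attains_max0; apply: attains_ext (known N _ 0) => w.
    by rewrite /t !mxE.
  pose G w := col_mx (usubmx w) (col_mx
    (\mxcol_k vec (psd_part eig (mat (s w k))))
    (col_mx (y w) (col_mx (z w) (Num.max 0 (t w))%:M))).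
  have GP : attains eigcost ((c + 7) * \sum_(k < p) #|C k| ^ 3)
      (input_available eig N) (available_mx eig G).
    rewrite -[X in attains _ X _ _]addn0.
    have stG := stable_available_mx (fun w => \mxcol_k vec (psd_part eig (F k w))).
    apply: (attains_weak _ _ (leqnn _) (attains_and (stX N) (stG _) sP tP)) => //.
    move=> cs [inP psdP maxP].
    refine (available_col_mx _ (available_col_mx psdP
      (available_col_mx _ (available_col_mx _ _)))).
    - by move=> i j; apply: available_ext (inP _ j) => w; rewrite mxE.
    - by move=> i j; apply: available_ext (inP _ j) => w; rewrite !mxE.
    - by move=> i j; apply: available_ext (inP _ j) => w; rewrite !mxE.
    by move=> i j; apply: available_ext maxP => w; rewrite !ord1 mxE mulr1n.
  have [P le_P PE] := attains_exec GP.
  exists P => // uhat v; rewrite PE; move: (uhat - v) => w.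
  by rewrite [in RHS](wE w) (proj_hsde_cone eigP).
Qed.
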